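(* The following two statements are equivalent. (A) (Union-closed sets conjecture) For every finite union-closed set $\mathcal X$ of finite sets with $\mathcal X\neq\{\emptyset\}$, there is an element $x\in\bigcup_{X\in\mathcal X}X$ that lies in at least half of the members of $\mathcal X$. (B) For every finite bipartite graph $G$ with at least one edge and with bipartition classes $U,W$, each of $U$ and $W$ contains a vertex belonging to at most half of the maximal stable sets of $G$.
   Context: A set $\mathcal X$ of sets is union-closed if $X,Y\in\mathcal X$ implies $X\cup Y\in\mathcal X$. A set of vertices of a graph is stable if no two of its vertices are adjacent; a stable set is maximal if it is maximal under inclusion.
   Formalization: In statement (A) the family is also required to be nonempty, since the empty family is union-closed, differs from {∅}, and has no element in its union, which would make (A) false as literally written. *)

(* Defs.v *)
From mathcomp Require Import all_boot finmap.

Set Implicit Arguments.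
Unset Strict Implicit.
Unset Printing Implicit Defensive.

Definition union_closed (K : choiceType) (X : {fset {fset K}}) : Prop :=
  forall A B : {fset K}, A \in X -> B \in X -> (A `|` B)%fset \in X.

Definition members_with (K : choiceType) (X : {fset {fset K}}) (x : K) :
    {fset {fset K}} :=
  [fset A in X | x \in A]%fset.

(* The empty family is excluded: its union has no element, so the union-closed
   sets conjecture is tacitly about nonempty families. *)
Definition union_closed_sets_conjecture : Prop :=
  forall (K : choiceType) (X : {fset {fset K}}),
    union_closed X -> X <> fset0 -> X <> [fset fset0]%fset ->
    exists2 x : K, x \in (\bigcup_(A <- X) A)%fset
                 & #|` X| <= 2 * #|` members_with X x|.

Definition simple_graph (V : finType) (e : rel V) : Prop :=
  symmetric e /\ irreflexive e.

Definition stable (V : finType) (e : rel V) (S : {set V}) : bool :=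
  [forall u in S, forall v in S, ~~ e u v].

Definition bipartition (V : finType) (e : rel V) (U W : {set V}) : Prop :=
  [/\ U :|: W = [set: V], [disjoint U & W], stable e U & stable e W].

Definition max_stable_sets (V : finType) (e : rel V) : {set {set V}} :=
  [set S : {set V} | maxset (stable e) S].

Definition in_at_most_half (V : finType) (e : rel V) (v : V) : Prop :=
  2 * #|[set S in max_stable_sets e | v \in S]| <= #|max_stable_sets e|.

Definition bipartite_stable_sets_conjecture : Prop :=
  forall (V : finType) (e : rel V) (U W : {set V}),
    simple_graph e -> bipartition e U W -> (exists u v : V, e u v) ->
    (exists2 u, u \in U & in_at_most_half e u) /\
    (exists2 w, w \in W & in_at_most_half e w).

(* Main.v *)
Require Import Defs.
From mathcomp Require Import all_boot finmap.

Set Implicit Arguments.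
Unset Strict Implicit.
Unset Printing Implicit Defensive.

(** In a bipartite graph with classes [U] and [W], a maximal stable set [S] is
    determined by its trace on [U], and the sets [U \ S] are exactly the
    neighbourhoods [N(B)] of the subsets [B] of [W].  These neighbourhoods form
    a union-closed family, in which [u] lies in at least half of the members iff
    [u] lies in at most half of the maximal stable sets.  Conversely, every
    union-closed family is, up to the empty set, the family of neighbourhoods
    of its own incidence graph. *)

Definition nbh (V : finType) (e : rel V) (B : {set V}) : {set V} :=
  [set v | [exists w in B, e w v]].

Definition nbhs (V : finType) (e : rel V) (W : {set V}) : {set {set V}} :=
  [set nbh e B | B in powerset W].

(** * Neighbourhoods and maximal stable sets in a graph *)

Section Neighbourhoods.

Variables (V : finType) (e : rel V).

Lemma nbhP (B : {set V}) v : reflect (exists2 w, w \in B & e w v) (v \in nbh e B).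
Proof. by rewrite inE; apply: exists_inP. Qed.

Lemma nbh0 : nbh e set0 = set0.
Proof.
by apply/setP=> v; rewrite in_set0; apply/nbhP=> -[w]; rewrite inE.
Qed.

Lemma nbhU (B C : {set V}) : nbh e (B :|: C) = nbh e B :|: nbh e C.
Proof.
apply/setP=> v; rewrite in_setU; apply/nbhP/orP.
  by case=> w /setUP[wB|wC] wv; [left|right]; apply/nbhP; exists w.
by case=> /nbhP[w wB wv]; exists w; rewrite // inE wB ?orbT.
Qed.

Lemma nbhsU (W N M : {set V}) :
  N \in nbhs e W -> M \in nbhs e W -> N :|: M \in nbhs e W.
Proof.
case/imsetP=> B BW ->; case/imsetP=> C CW ->; rewrite -nbhU.
by apply: imset_f; rewrite powersetE subUset -!powersetE BW.
Qed.

Lemma stableP (S : {set V}) :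
  reflect (forall u v, u \in S -> v \in S -> ~~ e u v) (stable e S).
Proof.
apply: (iffP forall_inP) => [h u v uS vS|h u uS].
  by move/forall_inP: (h _ uS); apply.
by apply/forall_inP => v vS; apply: h.
Qed.

(** Stability says that [S] avoids its own neighbourhood; maximality gives the other inclusion,
    since a vertex with no neighbour in [S] could be added to [S]. *)
Lemma max_stableP (S : {set V}) : simple_graph e ->
  reflect (S = ~: nbh e S) (S \in max_stable_sets e).
Proof.
case=> sym_e irr_e; rewrite inE; apply: (iffP maxsetP) => [[/stableP stS maxS]|eS].
  apply/setP=> v; rewrite in_setC; apply/idP/idP => [vS|/nbhP nNv].
    by apply/nbhP=> -[w wS]; apply/negP/stS.
  rewrite -(maxS (v |: S)) ?setU11 ?subsetUr //.
  have nv w : w \in S -> ~~ e w v by move=> wS; apply/negP=> wv; apply: nNv; exists w.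
  apply/stableP=> x y /setU1P[->|xS] /setU1P[->|yS].
  - by rewrite irr_e.
  - by rewrite sym_e nv.
  - exact: nv.
  - exact: stS.
have stS : stable e S.
  apply/stableP=> u v uS; rewrite {1}eS in_setC; apply: contra => uv.
  by apply/nbhP; exists u.
split=> // T /stableP stT sST; apply/eqP; rewrite eqEsubset sST andbT.
apply/subsetP=> v vT; rewrite eS in_setC; apply/nbhP=> -[w wS].
by apply/negP/stT => //; apply: (subsetP sST).
Qed.

End Neighbourhoods.

(** * Neighbourhoods and maximal stable sets in a bipartite graph *)

Section Bipartite.

Variables (V : finType) (e : rel V) (U W : {set V}).
Hypotheses (Ge : simple_graph e) (UW : bipartition e U W).

Lemma bipartition_sym : bipartition e W U.
Proof. by case: UW => ? ? ? ?; split; rewrite 1?setUC 1?disjoint_sym. Qed.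

Lemma setC_bipartition v : (v \in W) = (v \notin U).
Proof.
case: UW => /setP/(_ v) + dUW _ _; rewrite !inE.
have := disjointFr dUW (x := v); case: (v \in U) => [->|_ /= ->] //.
Qed.

Lemma edge_bipartition u v : e u v -> (u \in W) = (v \in U).
Proof.
case: UW => _ _ /stableP stU /stableP stW uv.
have := setC_bipartition u; have := setC_bipartition v.
move: (stU u v) (stW u v); rewrite uv.
by case: (u \in U) (v \in U) (u \in W) (v \in W) => [] [] [] [] //= h1 h2;
  [have := h1 isT isT | have := h2 isT isT].
Qed.

Lemma nbh_sub (B : {set V}) : B \subset W -> nbh e B \subset U.
Proof.
move/subsetP=> BW; apply/subsetP=> v /nbhP[w wB wv].
by rewrite -(edge_bipartition wv) BW.
Qed.

Lemma in_nbh_trace (S : {set V}) v :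
  v \in U -> (v \in nbh e S) = (v \in nbh e (S :&: W)).
Proof.
move=> vU; apply/nbhP/nbhP => -[w wS wv]; exists w => //.
  by rewrite inE wS (edge_bipartition wv).
by case/setIP: wS.
Qed.

(** By maximality a vertex of [U] is missing from [S] exactly when it has a neighbour in [S], and
    that neighbour must lie in [W]. *)
Lemma max_stable_setD (S : {set V}) :
  S \in max_stable_sets e -> U :\: S = nbh e (S :&: W).
Proof.
move/(max_stableP _ Ge)=> eS; apply/setP=> v; rewrite in_setD.
have [vU|vU] := boolP (v \in U).
  by rewrite {1}eS in_setC negbK in_nbh_trace // andbT.
rewrite andbF; apply/esym/negbTE; apply: contra vU.
exact/subsetP/nbh_sub/subsetIr.
Qed.

End Bipartite.

(** * The bijection between maximal stable sets and neighbourhoods *)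

Section Trace.

Variables (V : finType) (e : rel V) (U W : {set V}).
Hypotheses (Ge : simple_graph e) (UW : bipartition e U W).

(** The trace on [U] also fixes the trace on [W], by [max_stable_setD] with the two classes
    exchanged. *)
Lemma max_stable_setD_inj : {in max_stable_sets e &, injective (setD U)}.
Proof.
move=> S T mS mT eUST.
have eU : S :&: U = T :&: U.
  apply/setP=> v; move/setP/(_ v): eUST; rewrite !inE.
  by case: (v \in U); rewrite ?andbF ?andbT //; apply: negb_inj.
have eW : W :\: S = W :\: T.
  by rewrite !(max_stable_setD Ge (bipartition_sym UW)) // eU.
apply/setP=> v; move/setP/(_ v): eUST; move/setP/(_ v): eW.
rewrite !inE (setC_bipartition UW).
by case: (v \in U); rewrite ?andbT => h1 h2; apply: negb_inj.
Qed.

Lemma imset_max_stable_setD : setD U @: max_stable_sets e = nbhs e W.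
Proof.
have WU := bipartition_sym UW.
apply/setP=> N; apply/imsetP/imsetP => -[].
  move=> S mS ->; exists (S :&: W); first by rewrite powersetE subsetIr.
  exact: (max_stable_setD Ge UW).
move=> B; rewrite powersetE => BW ->; set A := U :\: nbh e B.
(* The required maximal stable set: remove the neighbours of [B] from [U], then add every vertex of
   [W] that has no neighbour in what remains. *)
pose S := A :|: (W :\: nbh e A).
have SU : S :&: U = A.
  apply/setP=> v; rewrite !inE (setC_bipartition UW).
  by case: (v \in U); rewrite ?andbF ?orbF ?andbT.
have SW : S :&: W = W :\: nbh e A.
  apply/setP=> v; rewrite !inE (setC_bipartition UW).
  by case: (v \in U); rewrite ?andbF ?orbF ?andbT.
(* Enlarging [B] to [W :\: nbh e A] creates no new neighbours in [U]: a vertex of [U] outside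
   [nbh e B] lies in [A], so its neighbours have been discarded. *)
have eN v : v \in U -> (v \in nbh e (W :\: nbh e A)) = (v \in nbh e B).
  move=> vU; apply/nbhP/nbhP => -[w wB wv]; last first.
    exists w => //; rewrite inE (subsetP BW) // andbT.
    apply/nbhP=> -[u /setDP[_ /nbhP nu] uw]; apply: nu; exists w => //.
    by rewrite (proj1 Ge).
  apply/nbhP; apply: contraT => vB; case/setDP: wB => _ /nbhP[].
  by exists v; rewrite 1?(proj1 Ge) // inE vB.
have mS : S \in max_stable_sets e.
  apply/(max_stableP _ Ge)/setP=> v; rewrite [RHS]inE.
  have [vU|] := boolP (v \in U).
    rewrite (in_nbh_trace UW) // SW eN // !inE vU (setC_bipartition UW) vU.
    by rewrite andbF orbF andbT.
  rewrite -(setC_bipartition UW) => vW.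
  by rewrite (in_nbh_trace WU) // SU !inE (setC_bipartition WU) vW andbF andbT.
exists S => //; rewrite (max_stable_setD Ge UW) // SW.
apply/setP=> v; have [/eN ->//|vU] := boolP (v \in U).
have vN (C : {set V}) : C \subset W -> (v \in nbh e C) = false.
  by move=> CW; apply: contraNF vU; apply/subsetP/(nbh_sub UW).
by rewrite !vN ?subsetDl.
Qed.

(** Under the bijection sending [S] to [U :\: S], the neighbourhoods containing [u] correspond to
    the maximal stable sets avoiding [u]. *)
Lemma in_at_most_halfE u : u \in U ->
  in_at_most_half e u <-> #|nbhs e W| <= 2 * #|[set N in nbhs e W | u \in N]|.
Proof.
move=> uU; rewrite /in_at_most_half -imset_max_stable_setD.
rewrite (card_in_imset max_stable_setD_inj).
have -> : [set N in setD U @: max_stable_sets e | u \in N]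
   = setD U @: [set S in max_stable_sets e | u \notin S].
  apply/setP=> N; rewrite inE; apply/andP/imsetP => -[].
    by case/imsetP=> S mS -> /setDP[_ uS]; exists S; rewrite // inE mS.
  by move=> S /setIdP[mS uS] ->; rewrite imset_f // inE uS.
rewrite card_in_imset; last first.
  by move=> S T /setIdP[mS _] /setIdP[mT _]; apply: max_stable_setD_inj.
set M := max_stable_sets e.
have -> : #|M| = #|[set S in M | u \in S]| + #|[set S in M | u \notin S]|.
  rewrite -(cardsID [set S : {set V} | u \in S] M); congr (_ + _);
  by apply: eq_card => S; rewrite !inE // andbC.
(* With [a] sets containing [u] and [b] avoiding it, both sides say that [a <= b]. *)
by rewrite !mul2n -!addnn leq_add2l leq_add2r.
Qed.

End Trace.

(** * From union-closed families to bipartite graphs *)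

Lemma union_closed_half_nbhs (V : finType) (e : rel V) (W : {set V}) :
  union_closed_sets_conjecture ->
  (exists2 w, w \in W & exists v, e w v) ->
  exists2 u, u \in nbh e W & #|nbhs e W| <= 2 * #|[set N in nbhs e W | u \in N]|.
Proof.
move=> ucs [w wW [v wv]].
pose f (N : {set V}) : {fset V} := [fset x in N]%fset.
have fE N x : (x \in f N) = (x \in N) by rewrite in_fset.
have f_inj : injective f by move=> N M eNM; apply/setP=> x; rewrite -!fE eNM.
pose F (Y : {set {set V}}) : {fset {fset V}} := [fset f N | N in Y]%fset.
have cardF Y : #|` F Y| = #|Y|.
  by rewrite card_imfset //= cardE.
have F_uc : union_closed (F (nbhs e W)).
  move=> _ _ /imfsetP[/= N NW ->] /imfsetP[/= M MW ->].
  have -> : (f N `|` f M)%fset = f (N :|: M).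
    by apply/fsetP=> x; rewrite in_fsetU !fE inE.
  by apply: in_imfset; apply: nbhsU.
(* This member contains [v], so the family is neither empty nor reduced to the empty set. *)
have FN : f (nbh e [set w]) \in F (nbhs e W).
  by apply/in_imfset/imset_f; rewrite powersetE sub1set.
have vN : v \in f (nbh e [set w]) by rewrite fE; apply/nbhP; exists w; rewrite ?inE.
case: (ucs V _ F_uc).
- by move=> F0; move: FN; rewrite F0 in_fset0.
- by move=> F1; move: FN vN; rewrite F1 => /fset1P ->; rewrite in_fset0.
move=> u /bigfcupP[A /andP[/imfsetP[/= N NW ->] _]]; rewrite fE => uN.
rewrite cardF => h; exists u.
  case/imsetP: NW uN => B; rewrite powersetE => /subsetP BW -> /nbhP[b /BW bW bu].
  by apply/nbhP; exists b.
apply: leq_trans h _; rewrite leq_mul2l /= -cardF; apply: fsubset_leq_card.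
apply/fsubsetP=> {}A; rewrite !inE /= => /andP[/imfsetP[/= M MW ->]].
by rewrite fE => uM; apply: in_imfset; rewrite inE MW.
Qed.

Lemma bipartite_of_union_closed :
  union_closed_sets_conjecture -> bipartite_stable_sets_conjecture.
Proof.
move=> ucs V e U W Ge UW [x [y xy]].
suff half (A B : {set V}) : bipartition e A B ->
    exists2 u, u \in A & in_at_most_half e u.
  by split; apply: half; [exact: UW | exact: bipartition_sym UW].
move=> AB; have eB : exists2 w, w \in B & exists v, e w v.
  have [xB|xB] := boolP (x \in B); first by exists x; last exists y.
  exists y; last by exists x; rewrite (proj1 Ge).
  by rewrite (setC_bipartition AB) -(edge_bipartition AB xy).
have [u uB hu] := union_closed_half_nbhs ucs eB.
have uA : u \in A by apply: (subsetP (nbh_sub AB (subxx B))).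
by exists u => //; apply/(in_at_most_halfE Ge AB uA).
Qed.

(** * From bipartite graphs to union-closed families *)

Section IncidenceGraph.

Variables (K : choiceType) (X : {fset {fset K}}).

(** [K] may be infinite; restricting to elements that occur in some member keeps the vertex type
    [X + D] finite. *)
Let D : {fset K} := (\bigcup_(A <- X) A)%fset.

Definition incidence (a b : X + D) : bool :=
  match a, b with
  | inl A, inr x | inr x, inl A => val x \in val A
  | _, _ => false
  end.

Let U : {set X + D} := [set inr x | x in [set: D]].
Let W : {set X + D} := [set inl A | A in [set: X]].

Lemma incidence_simple : simple_graph incidence.
Proof. by split=> [[A|x] [B|y]|[A|x]]. Qed.

Lemma incidence_bipartition : bipartition incidence U W.
Proof.
split.
- by apply/setP=> -[A|x]; rewrite !inE !imset_f ?orbT.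
- rewrite disjoint_subset; apply/subsetP=> _ /imsetP[x _ ->].
  by rewrite inE; apply/imsetP=> -[].
- by apply/stableP=> _ _ /imsetP[x _ ->] /imsetP[y _ ->].
- by apply/stableP=> _ _ /imsetP[A _ ->] /imsetP[B _ ->].
Qed.

Lemma in_nbh_incidence1 (A : X) (x : D) :
  (inr x \in nbh incidence [set inl A]) = (val x \in val A).
Proof.
apply/nbhP/idP => [[w /set1P ->] //|xA].
by exists (inl A); rewrite ?set11.
Qed.

Lemma nbh_incidence1_inj : injective (fun A : X => nbh incidence [set inl A]).
Proof.
move=> A B /= eAB; apply/val_inj/fsetP=> x.
have sub (C : X) : x \in val C -> x \in D.
  by move=> xC; apply/bigfcupP; exists (val C); rewrite ?fsvalP.
apply/idP/idP => xC; have xD := sub _ xC.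
  by rewrite -[x]/(val [` xD]%fset) -in_nbh_incidence1 -eAB in_nbh_incidence1.
by rewrite -[x]/(val [` xD]%fset) -in_nbh_incidence1 eAB in_nbh_incidence1.
Qed.

Lemma nbh_incidence1U (A B C : X) : val C = (val A `|` val B)%fset ->
  nbh incidence [set inl A] :|: nbh incidence [set inl B]
    = nbh incidence [set inl C].
Proof.
move=> eC; apply/setP=> -[E|x]; rewrite in_setU; last first.
  by rewrite !in_nbh_incidence1 eC in_fsetU.
by rewrite ![inl E \in _](introF (nbhP _ _ _)) // => -[w /set1P ->].
Qed.

(** The neighbourhood of [B] is the union of the members in [B], which is again a member by
    induction on the size of [B]. The empty [B] stands apart because [X] need not contain the empty
    set. *)
Lemma nbh_incidence (B : {set X + D}) : union_closed X -> B \subset W ->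
  B = set0 \/ exists A : X, nbh incidence B = nbh incidence [set inl A].
Proof.
move=> ucX; have [n] := ubnP #|B|; elim: n B => // n IHn B ltB BW.
have [->|[b bB]] := set_0Vmem B; first by left.
right; have /imsetP[A _ eb] := subsetP BW _ bB.
rewrite -(setD1K bB) nbhU eb.
case: (IHn (B :\ b)).
- by move: ltB; rewrite (cardsD1 b B) bB.
- by rewrite (subset_trans (subD1set _ _)).
- by rewrite -eb => ->; rewrite nbh0 setU0; exists A; rewrite eb.
case=> C; rewrite -eb => ->.
pose E : X := [` ucX _ _ (fsvalP A) (fsvalP C)]%fset.
by exists E; rewrite eb; apply: nbh_incidence1U.
Qed.

Lemma card_members_with (x : K) :
  #|[set A : X | x \in val A]| = #|` members_with X x|.
Proof.
have -> : members_with X x = [fset val A | A in [set A : X | x \in val A]]%fset.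
  apply/fsetP=> B; rewrite !inE /=; apply/andP/imfsetP => /= -[].
    by move=> BX xB; exists [` BX]%fset; rewrite ?inE.
  by move=> A; rewrite inE => xA ->; rewrite fsvalP.
by rewrite card_imfset /= ?cardE //; apply: val_inj.
Qed.

(** The neighbourhoods are the members of [X], plus possibly the empty set. This extra set can only
    increase the total and never contains [x], so the bound passes to [X]. *)
Lemma half_nbhs_incidence (x : D) : union_closed X ->
  #|nbhs incidence W| <= 2 * #|[set N in nbhs incidence W | inr x \in N]| ->
  #|` X| <= 2 * #|` members_with X (val x)|.
Proof.
move=> ucX half; rewrite -card_members_with cardfE.
apply: leq_trans (leq_trans half _).
  rewrite -cardsT -(card_imset _ nbh_incidence1_inj); apply: subset_leq_card.
  apply/subsetP=> _ /imsetP[A _ ->]; apply: imset_f.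
  by rewrite powersetE sub1set imset_f.
rewrite leq_mul2l /= -(card_imset _ nbh_incidence1_inj); apply: subset_leq_card.
apply/subsetP=> N /setIdP[/imsetP[B]]; rewrite powersetE => BW -> xB.
case: (nbh_incidence ucX BW) => [B0|[A eA]]; first by rewrite B0 nbh0 inE in xB.
by rewrite eA; apply/imsetP; exists A; rewrite // inE -in_nbh_incidence1 -eA.
Qed.

Lemma union_closed_half : bipartite_stable_sets_conjecture ->
  union_closed X -> X <> fset0 -> X <> [fset fset0]%fset ->
  exists2 x, x \in D & #|` X| <= 2 * #|` members_with X x|.
Proof.
move=> bss ucX X0 X1.
(* A nonempty member provides the edge that the statement on bipartite graphs requires. *)
have [A AX [a aA]] : exists2 A, A \in X & exists a, a \in A.
  have [|X01] := boolP (X `<=` [fset fset0])%fset.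
    by rewrite fsubset1 => /orP[] /eqP.
  have /fsubsetPn[A AX] := X01; rewrite in_fset1 => /fset0Pn[a aA].
  by exists A => //; exists a.
have aD : a \in D by apply/bigfcupP; exists A; rewrite ?AX.
have [|[_ /imsetP[x _ ->]] half _] :=
    bss _ _ _ _ incidence_simple incidence_bipartition.
  by exists (inl [` AX]%fset), (inr [` aD]%fset).
exists (val x); first exact: fsvalP.
apply: half_nbhs_incidence => //.
by apply/(in_at_most_halfE incidence_simple incidence_bipartition); rewrite ?imset_f.
Qed.

End IncidenceGraph.

Theorem theorem5 :
  union_closed_sets_conjecture <-> bipartite_stable_sets_conjecture.
Proof.
split; first exact: bipartite_of_union_closed.
by move=> bss K X; apply: union_closed_half.
Qed.
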